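(* For every integer $n\geq 1$, the HOMFLY polynomial of $T(-3,n)$ is $$P(T(-3,n);y,z)=(y^{-2}+1)z^{-2}\widetilde{G}_{n+3}+\bigl((1+y^2)z^{-2}-y^2\bigr)\widetilde{G}_{n+2}+\bigl(y^6-(y^6+y^8)z^{-2}\bigr)\widetilde{G}_n-(y^8+y^{10})z^{-2}\widetilde{G}_{n-1},$$ where $\widetilde{G}_n$ is obtained from $G_n$ by substituting $y\mapsto y^{-1}$, and $(G_n)_{n\ge0}$ is defined by $$\frac{X^3}{1-(y^{-2}z^2-y^{-2})X+y^{-4}z^2X^2-(y^{-6}z^2-y^{-6})X^3+y^{-8}X^4}=\sum_{n=0}^\infty G_nX^n$$ in $\mathbb{Q}(y,z)[[X]]$.
   Context: A crossing of an oriented link diagram in the oriented plane is positive if the ordered pair (tangent vector of the overpassing arc, tangent vector of the underpassing arc) agrees with the orientation of the plane, and negative otherwise. $B_m$ denotes the braid group on $m$ strands with Artin generators $\sigma_1,\dots,\sigma_{m-1}$, where $\sigma_i$ is the elementary braid in which the $i$th and $(i+1)$st strands form a positive crossing (all strands oriented in the same direction along the braid). $\overline{x}$ denotes the closure of a braid $x$, an oriented link. For an integer $m\ge2$ and $n\in\mathbb{Z}$, $T(m,n)=\overline{(\sigma_1\sigma_2\cdots\sigma_{m-1})^n}$. The link $T(-m,n)$ is the mirror image of $T(m,n)$: the closure of the oriented diagram obtained by reversing every crossing in the standard closed braid diagram of $(\sigma_1\cdots\sigma_{m-1})^n$, with the orientation induced from that diagram. The HOMFLY polynomial $P(L;y,z)\in\mathbb{Z}[y^{\pm1},z^{\pm1}]$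 of an oriented link $L$ is the unique oriented link invariant, computed from any diagram, with $P(\text{unknot};y,z)=1$ and $yP(D_+;y,z)+y^{-1}P(D_-;y,z)=zP(D_0;y,z)$ for every skein triple $(D_+,D_-,D_0)$, i.e. three oriented diagrams identical except near one crossing, where the crossing is respectively positive, negative, and smoothed (orientation-consistently). *)

(* Defs.v *)
From HB Require Import structures.
From Stdlib Require Import Relation_Operators.
From mathcomp Require Import all_boot all_order all_algebra.

Set Implicit Arguments.
Unset Strict Implicit.
Unset Printing Implicit Defensive.

Import Order.TTheory GRing.Theory Num.Theory.

Local Open Scope ring_scope.

(* Oriented link diagrams in the plane, in generic position with respect to   *)
(* the height function and read from bottom to top.  Each slice (k, p)        *)
(* consists of vertical strands, except for one elementary piece p at         *)
(* (0-based) position k from the left:                                        *)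
(*   Cup d    a local minimum, creating strands k and k+1, of which strand k  *)
(*            points up if d and down otherwise (strand k+1 the opposite);    *)
(*   Cap      a local maximum, joining strands k and k+1;                     *)
(*   Cross o  a crossing of strands k and k+1; the strand running along the   *)
(*            SW-NE diagonal is over if o, and under otherwise.               *)
(* The orientations of the strands cut by a horizontal line, from left to     *)
(* right, form a seq bool (true = up).                                        *)
Inductive piece := Cup of bool | Cap | Cross of bool.

Notation slice := (nat * piece)%type.

Definition step (s : seq bool) (e : slice) : option (seq bool) :=
  let: (k, p) := e in
  match p with
  | Cup d => if (k <= size s)%N
             then Some (take k s ++ [:: d, ~~ d & drop k s]) else None
  | Cap => if drop k s is a :: b :: t then
             if a != b then Some (take k s ++ t) else None
           else None
  | Cross _ => if drop k s is a :: b :: t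
               then Some (take k s ++ [:: b, a & t]) else None
  end.

(* None when the slices do not fit together or orientations clash. *)
Fixpoint run (s : seq bool) (w : seq slice) : option (seq bool) :=
  if w is e :: w' then obind (run^~ w') (step s e) else Some s.

Record link_diagram := LinkDiagram {
  slices :> seq slice;
  slicesP : run [::] slices == Some [::] }.

HB.instance Definition _ := [isSub for slices].

(* Numbers of lower and of upper endpoints. *)
Definition lower (p : piece) : nat := if p is Cup _ then 0 else 2.
Definition upper (p : piece) : nat := if p is Cap then 0 else 2.

(* Planar isotopies and Reidemeister moves for diagrams cut into slices.      *)
(* Since only cups record orientations, each clause stands for all the        *)
(* orientations of the strands involved.                                      *)
Inductive move : seq slice -> seq slice -> Prop :=
(* change of the relative height of two far apart pieces *)
| Exchange i p j q : (i + lower p <= j)%N ->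
    move [:: (j, q); (i, p)] [:: (i, p); ((j - lower p + upper p)%N, q)]
(* cancellation of a minimum with an adjacent maximum *)
| ZigzagL k d : move [:: (k, Cup d); (k.+1, Cap)] [::]
| ZigzagR k d : move [:: (k.+1, Cup d); (k, Cap)] [::]
(* a strand passing over or under a minimum or a maximum *)
| SlideCup k d o : move [:: (k, Cup d); (k.+1, Cross o)]
                        [:: (k.+1, Cup d); (k, Cross (~~ o))]
| SlideCap k o : move [:: (k.+1, Cross o); (k, Cap)]
                      [:: (k, Cross (~~ o)); (k.+1, Cap)]
| Reidemeister1R k d o :
    move [:: (k.+1, Cup d); (k, Cross o); (k.+1, Cap)] [::]
| Reidemeister1L k d o :
    move [:: (k, Cup d); (k.+1, Cross o); (k, Cap)] [::]
| Reidemeister2 k o : move [:: (k, Cross o); (k, Cross (~~ o))] [::]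
(* the side condition says that one strand is over both others and one is    *)
(* under both others                                                          *)
| Reidemeister3 k a b c : (b == a) || (b == c) ->
    move [:: (k, Cross a); (k.+1, Cross b); (k, Cross c)]
         [:: (k.+1, Cross c); (k, Cross b); (k.+1, Cross a)].

Definition move_step (D D' : link_diagram) : Prop :=
  exists u v l r : seq slice,
    [/\ move l r, D = u ++ l ++ v :> seq slice & D' = u ++ r ++ v :> seq slice].

(* Oriented links are the classes of link diagrams for this relation. *)
Definition isotopic : link_diagram -> link_diagram -> Prop :=
  clos_refl_sym_trans link_diagram move_step.

Definition unknot : link_diagram :=
  @LinkDiagram [:: (0%N, Cup true); (0%N, Cap)] isT.

(* Tangent vectors in the plane of the strands of a crossing, depending on    *)
(* whether they point up.                                                     *)
Definition tangentSWNE (up : bool) : int * int := if up then (1, 1) else (-1, -1).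
Definition tangentSENW (up : bool) : int * int := if up then (-1, 1) else (1, -1).

Definition det2 (u v : int * int) : int := u.1 * v.2 - u.2 * v.1.

(* a and b are the orientations of the strands below the crossing: a that of  *)
(* the strand starting at SW, b that of the strand starting at SE.            *)
Definition positive (a b o : bool) : bool :=
  let: (over, under) := if o then (tangentSWNE a, tangentSENW b)
                        else (tangentSENW b, tangentSWNE a) in
  0 < det2 over under.

Definition smoothing (k : nat) (a b : bool) : seq slice :=
  if a == b then [::] else [:: (k, Cap); (k, Cup b)].

Definition skein_triple (Dp Dm D0 : link_diagram) : Prop :=
  exists (u v : seq slice) (s t : seq bool) (a b o : bool),
    let k := size s in
    [/\ run [::] u = Some (s ++ [:: a, b & t]), positive a b o,
        Dp = u ++ (k, Cross o) :: v :> seq slice,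
        Dm = u ++ (k, Cross (~~ o)) :: v :> seq slice &
        D0 = u ++ smoothing k a b ++ v :> seq slice].

(* The field Q(y, z); in {poly {poly rat}} the outer variable is y and the    *)
(* inner one is z.                                                            *)
Notation Qyz := {fraction {poly {poly rat}}}.
Local Notation frac := (@FracField.tofrac {poly {poly rat}}).

Definition y : Qyz := frac 'X.
Definition z : Qyz := frac ('X)%:P.

(* Membership in Z[y^{+-1}, z^{+-1}]. *)
Definition laurent (f : Qyz) : Prop :=
  exists (p : {poly {poly int}}) (a b : nat),
    f = frac (map_poly (map_poly (intr : int -> rat)) p) / (y ^+ a * z ^+ b).

Record is_homfly (P : link_diagram -> Qyz) : Prop := IsHomfly {
  homfly_laurent : forall D, laurent (P D);
  homfly_invariant : forall D D', isotopic D D' -> P D = P D';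
  homfly_unknot : P unknot = 1;
  homfly_skein : forall Dp Dm D0, skein_triple Dp Dm D0 ->
    y * P Dp + y^-1 * P Dm = z * P D0 }.

(* Words in the Artin generators of the braid group on m strands: (i, true)   *)
(* is sigma_{i+1} and (i, false) is its inverse.                              *)
Notation braid_word m := (seq ('I_m.-1 * bool)).

Definition braid_inv m (b : braid_word m) : braid_word m :=
  rev [seq (x.1, ~~ x.2) | x <- b].

Definition braid_exp m (b : braid_word m) (n : int) : braid_word m :=
  match n with
  | Posz n' => flatten (nseq n' b)
  | Negz n' => flatten (nseq n'.+1 (braid_inv b))
  end.

(* The braid runs upwards on strands 0, ..., m-1; the closing strands are to  *)
(* its right.                                                                 *)
Definition closure_slices m (b : braid_word m) : seq slice :=
  [seq (i, Cup true) | i <- iota 0 m]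
  ++ [seq (nat_of_ord x.1, Cross x.2) | x <- b]
  ++ rev [seq (i, Cap) | i <- iota 0 m].

Lemma run_cat s u v : run s (u ++ v) = obind (run^~ v) (run s u).
Proof. by elim: u s => //= e u IHu s; case: (step s e). Qed.

Lemma run_cups m :
  run [::] [seq (i, Cup true) | i <- iota 0 m] =
  Some (nseq m true ++ nseq m false).
Proof.
elim: m => // m IHm; rewrite -addn1 iotaD map_cat run_cat IHm /= add0n.
rewrite size_cat !size_nseq leq_addr take_size_cat ?size_nseq //.
by rewrite drop_size_cat ?size_nseq // nseqD -catA addn1.
Qed.

Lemma run_caps m :
  run (nseq m true ++ nseq m false) (rev [seq (i, Cap) | i <- iota 0 m]) =
  Some [::].
Proof.
elim: m => // m IHm; rewrite -addn1 iotaD map_cat rev_cat run_cat /= add0n addn1.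
have -> : nseq m.+1 true ++ nseq m.+1 false
          = nseq m true ++ [:: true, false & nseq m false].
  by rewrite -[in LHS]addn1 nseqD -catA addn1.
by rewrite take_size_cat ?drop_size_cat ?size_nseq //= IHm.
Qed.

Lemma step_cross m i o : (i < m.-1)%N ->
  step (nseq m true ++ nseq m false) (i, Cross o) =
  Some (nseq m true ++ nseq m false).
Proof.
move=> lt_i; have -> : m = (i + (m - i.+2).+2)%N.
  by rewrite -!addSnnS subnKC //; case: m lt_i.
by rewrite nseqD -catA /= take_size_cat ?drop_size_cat ?size_nseq.
Qed.

Lemma run_braid m (b : braid_word m) :
  run (nseq m true ++ nseq m false) [seq (nat_of_ord x.1, Cross x.2) | x <- b] =
  Some (nseq m true ++ nseq m false).
Proof.
elim: b => // -[i o] b IHb.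
have /= -> // := step_cross o (ltn_ord i).
Qed.

Lemma closure_slicesP m (b : braid_word m) :
  run [::] (closure_slices b) == Some [::].
Proof. by rewrite !run_cat run_cups /= run_cat run_braid /= run_caps. Qed.

Definition braid_closure m (b : braid_word m) : link_diagram :=
  LinkDiagram (closure_slicesP b).

Definition mirror_slice (e : slice) : slice :=
  if e is (k, Cross o) then (k, Cross (~~ o)) else e.

Lemma run_mirror s w : run s (map mirror_slice w) = run s w.
Proof.
elim: w s => //= e w IHw s; have -> : step s (mirror_slice e) = step s e.
  by case: e => k [].
by case: (step s e).
Qed.

Lemma mirrorP (D : link_diagram) :
  run [::] (map mirror_slice D) == Some [::].
Proof. by rewrite run_mirror slicesP. Qed.

Definition mirror (D : link_diagram) : link_diagram := LinkDiagram (mirrorP D).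

(* sigma_1 sigma_2 ... sigma_{m-1} *)
Definition coxeter_braid m : braid_word m := [seq (i, true) | i <- enum 'I_m.-1].

(* T(m, n), meaningful when |m| >= 2. *)
Definition torus_link (m n : int) : link_diagram :=
  match m with
  | Posz m' => braid_closure (braid_exp (coxeter_braid m') n)
  | Negz m' => mirror (braid_closure (braid_exp (coxeter_braid m'.+1) n))
  end.

(* The coefficients of the quotient A / B in the ring of formal power series, *)
(* for polynomials A and B with B`_0 != 0.                                    *)
Fixpoint quot_coefs (K : fieldType) (A B : {poly K}) (n : nat) : seq K :=
  if n is m.+1 then
    let q := quot_coefs A B m in
    rcons q ((A`_m - \sum_(i < m) B`_(m - i) * q`_i) / B`_0)
  else [::].

Definition series_quot (K : fieldType) (A B : {poly K}) (n : nat) : K :=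
  (quot_coefs A B n.+1)`_n.

Lemma size_quot_coefs (K : fieldType) (A B : {poly K}) n :
  size (quot_coefs A B n) = n.
Proof. by elim: n => //= n IHn; rewrite size_rcons IHn. Qed.

Lemma nth_quot_coefs (K : fieldType) (A B : {poly K}) n i :
  (i < n)%N -> (quot_coefs A B n)`_i = series_quot A B i.
Proof.
elim: n => // n IHn; rewrite ltnS leq_eqVlt => /predU1P[-> // | lt_i_n].
by rewrite /= nth_rcons size_quot_coefs lt_i_n IHn.
Qed.

(* A = B * \sum_n (series_quot A B n) X^n *)
Lemma series_quotP (K : fieldType) (A B : {poly K}) n :
  B`_0 != 0 -> \sum_(i < n.+1) B`_(n - i) * series_quot A B i = A`_n.
Proof.
move=> B0; rewrite big_ord_recr /= subnn {2}/series_quot /=.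
rewrite nth_rcons size_quot_coefs ltnn eqxx mulrC divfK //.
under eq_bigr => i _ do rewrite -(nth_quot_coefs A B (ltn_ord i)).
by rewrite addrC subrK.
Qed.

Definition G : nat -> Qyz :=
  series_quot 'X^3
    (1 - (y ^- 2 * z ^+ 2 - y ^- 2) *: 'X + (y ^- 4 * z ^+ 2) *: 'X^2
       - (y ^- 6 * z ^+ 2 - y ^- 6) *: 'X^3 + y ^- 8 *: 'X^4).

(* The value of a polynomial in y and z at (y^-1, z). *)
Definition eval_yV (p : {poly {poly rat}}) : Qyz :=
  (map_poly (fun c : {poly rat} => frac c%:P) p).[y^-1].

(* The substitution y |-> y^-1 in a rational function. *)
Definition subst_yV (f : Qyz) : Qyz :=
  eval_yV \n_(repr f) / eval_yV \d_(repr f).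

Definition Gtilde (n : nat) : Qyz := subst_yV (G n).

(* Main.v *)
From HB Require Import structures.
From Stdlib Require Import Relation_Operators.
Require Import Defs.
From mathcomp Require Import all_boot all_order all_algebra.
From mathcomp Require Import ring.

Import GRing.Theory.
Local Open Scope ring_scope.

(** Mirroring turns T(-3, n) into the closure of (s1 s2)^n, where s1 and s2 now
    denote the inverses of the two Artin generators on three strands.  The
    skein relation at one of two consecutive equal crossings makes them satisfy
    s^2 = y z s - y^2, so that w |-> P(closure of w) factors through the Hecke
    algebra of the symmetric group S_3, of dimension 6 with basis
    1, s1, s2, s1 s2, s2 s1, s1 s2 s1.

    Put A = s1 s2.  The eigenvalues of s are the roots of t^2 - y z t + y^2.
    The element A acts on the two characters of the Hecke algebra by the
    squares of these roots, and on its two-dimensional representation with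
    characteristic polynomial t^2 - y^2 t + y^4.  Hence A is annihilated by
      (t^2 - (y^2 z^2 - 2 y^2) t + y^4) (t^2 - y^2 t + y^4),
    and after the substitution y |-> y^-1 the denominator of the generating
    series of the G_n is exactly the reciprocal of this quartic.  Therefore
    P(T(-3, n)), and any fixed combination of shifts of the substituted
    sequence, satisfy the same linear recurrence of order 4, and only four
    initial values have to be compared.

    No representation theory enters the proof: the six sequences
    P(closure of b A^n), for b in the basis, satisfy a linear system obtained
    by rewriting b A with the quadratic and the braid relations, and the
    recurrence of the first of them follows by elimination
    ([hecke3_recurrence]).  Their values at n = 0 come from [destabilization]:
    a crossing of the last strand that is the only one there can be removed
    together with that strand.  Combined with the skein relation it also gives
    the value of a disjoint circle ([homfly_widen]).

    On the algebraic side, the substitution y |-> y^-1 is defined through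
    unreduced numerators and denominators; it is a field endomorphism because
    y^-1 is transcendental over Q(z) ([eval_yV_eq0]). *)

(** * Closed braids *)

Local Notation strands m := (nseq m true ++ nseq m false).

Definition cups m : seq slice := [seq (i, Cup true) | i <- iota 0 m].
Definition caps m : seq slice := rev [seq (i, Cap) | i <- iota 0 m].
Definition crossings {m} (w : braid_word m) : seq slice :=
  [seq (nat_of_ord x.1, Cross x.2) | x <- w].

Lemma crossings_cat m (u v : braid_word m) :
  crossings (u ++ v) = crossings u ++ crossings v.
Proof. exact: map_cat. Qed.

Lemma cupsS m : cups m.+1 = rcons (cups m) (m, Cup true).
Proof. by rewrite /cups -addn1 iotaD map_cat cats1. Qed.

Lemma capsS m : caps m.+1 = (m, Cap) :: caps m.
Proof. by rewrite /caps -addn1 iotaD map_cat rev_cat. Qed.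

Lemma isotopic_move {D D' : link_diagram} {l r} u v : move l r ->
  D = u ++ l ++ v :> seq slice -> D' = u ++ r ++ v :> seq slice ->
  isotopic D D'.
Proof. by move=> lr DE D'E; apply: rst_step; exists u, v, l, r. Qed.

Lemma closure_slicesE m (w : braid_word m) :
  closure_slices w = cups m ++ crossings w ++ caps m.
Proof. by []. Qed.

Lemma closure_move m (u v l r : braid_word m) :
  move (crossings l) (crossings r) ->
  isotopic (braid_closure (u ++ l ++ v)) (braid_closure (u ++ r ++ v)).
Proof.
move=> lr.
by apply: (isotopic_move (cups m ++ crossings u) (crossings v ++ caps m) lr);
   rewrite /= closure_slicesE !crossings_cat !catA.
Qed.

Lemma closure_cancel {m} (u v : braid_word m) i o :
  isotopic (braid_closure (u ++ [:: (i, o); (i, ~~ o)] ++ v))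
           (braid_closure (u ++ v)).
Proof. exact/(closure_move _ _ _ _ [::])/Reidemeister2. Qed.

Lemma closure_braid {m} (u v : braid_word m) (i j : 'I_m.-1) o : j = i.+1 :> nat ->
  isotopic (braid_closure (u ++ [:: (i, o); (j, o); (i, o)] ++ v))
           (braid_closure (u ++ [:: (j, o); (i, o); (j, o)] ++ v)).
Proof.
move=> ij; apply: closure_move; rewrite /= ij.
by apply: Reidemeister3; rewrite eqxx.
Qed.

Lemma skein_closure {m} (u v : braid_word m) i :
  skein_triple (braid_closure (u ++ (i, true) :: v))
               (braid_closure (u ++ (i, false) :: v))
               (braid_closure (u ++ v)).
Proof.
(* Below the crossing there are i upward strands to the left of its two
   strands; to their right, the remaining ones and the closing strands. *)
exists (cups m ++ crossings u), (crossings v ++ caps m), (nseq i true),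
  (nseq (m - i.+2) true ++ nseq m false), true, true, true.
rewrite size_nseq /=; split=> //;
  rewrite ?closure_slicesE ?crossings_cat -?catA //=.
rewrite run_cat run_cups /= run_braid; congr Some.
have -> : [:: true, true & nseq (m - i.+2) true ++ nseq m false] =
  nseq (m - i.+2).+2 true ++ nseq m false by [].
by rewrite catA -nseqD -!addSnnS subnKC // -ltn_predRL ltn_ord.
Qed.

Definition widen_braid {m} (w : braid_word m.+1) : braid_word m.+2 :=
  [seq (widen_ord (leqnSn m) x.1, x.2) | x <- w].

Lemma crossings_widen m (w : braid_word m.+1) :
  crossings (widen_braid w) = crossings w.
Proof. by rewrite /crossings -map_comp. Qed.

(** The intermediate diagrams of a destabilization.  The arc closing the last
    strand opens after u1 and closes before v2, so that only u2, v1 and the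
    crossing between them lie alongside it; the closure of the stabilized braid
    has u1 and v2 empty, and the opposite extreme, with u2 and v1 empty, leaves a
    kink. *)
Definition half_closed_slices {m} (u1 u2 v1 v2 : braid_word m.+1) o : seq slice :=
  cups m.+1 ++ crossings u1 ++ (m.+1, Cup true) ::
  crossings u2 ++ (m, Cross o) :: crossings v1 ++ (m.+1, Cap) ::
  crossings v2 ++ caps m.+1.

Lemma strandsS m :
  strands m.+1 = nseq m true ++ [:: true, false & nseq m false].
Proof. by rewrite -[in LHS]addn1 nseqD -catA addn1. Qed.

Lemma step_cup m : step (strands m) (m, Cup true) = Some (strands m.+1).
Proof.
rewrite strandsS /= size_cat !size_nseq leq_addr.
by rewrite take_size_cat ?drop_size_cat ?size_nseq.
Qed.

Lemma step_cap m : step (strands m.+1) (m, Cap) = Some (strands m).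
Proof. by rewrite strandsS /= take_size_cat ?drop_size_cat ?size_nseq. Qed.

Lemma run_slice {s s'} {e : slice} w :
  step s e = Some s' -> run s (e :: w) = run s' w.
Proof. by move=> /= ->. Qed.

Lemma run_above_cups m w : run [::] (cups m ++ w) = run (strands m) w.
Proof. by rewrite run_cat run_cups. Qed.

Lemma run_crossings m (w : braid_word m) v :
  run (strands m) (crossings w ++ v) = run (strands m) v.
Proof. by rewrite run_cat run_braid. Qed.

Lemma half_closedP m (u1 u2 v1 v2 : braid_word m.+1) o :
  run [::] (half_closed_slices u1 u2 v1 v2 o) == Some [::].
Proof.
(* The words u2 and v1 are run among the strands of the larger braid. *)
rewrite /half_closed_slices -(crossings_widen _ u2) -(crossings_widen _ v1).
rewrite run_above_cups run_crossings.
rewrite (run_slice _ (step_cup _)) run_crossings.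
rewrite (run_slice _ (step_cross _ _)) // run_crossings.
by rewrite (run_slice _ (step_cap _)) run_crossings run_caps.
Qed.

Definition half_closed {m} (u1 u2 v1 v2 : braid_word m.+1) o :=
  LinkDiagram (half_closedP m u1 u2 v1 v2 o).

Lemma half_closed_cup {m} (u1 u2 v1 v2 : braid_word m.+1) o :
  isotopic (half_closed u1 u2 v1 v2 o) (half_closed (u1 ++ u2) [::] v1 v2 o).
Proof.
elim: u2 u1 => [|[i b] u2 IHu] u1; first by rewrite cats0; apply: rst_refl.
apply: rst_trans (_ : isotopic (half_closed (rcons u1 (i, b)) u2 v1 v2 o) _);
  last by rewrite -cat_rcons; apply: IHu.
have far : (i + lower (Cross b) <= m.+1)%N by rewrite addn2 !ltnS.
apply: (isotopic_move (cups m.+1 ++ crossings u1) (crossings u2 ++ _)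
  (Exchange (Cup true) far)).
  by rewrite /= /half_closed_slices -!catA.
rewrite /= /half_closed_slices /crossings map_rcons cat_rcons -!catA.
by rewrite subnK // (leq_trans (leq_addl _ _) far).
Qed.

Lemma half_closed_cap {m} (u1 u2 v1 v2 : braid_word m.+1) o :
  isotopic (half_closed u1 u2 v1 v2 o) (half_closed u1 u2 [::] (v1 ++ v2) o).
Proof.
elim/last_ind: v1 v2 => [|v1 [i b] IHv] v2; first exact: rst_refl.
apply: rst_trans (_ : isotopic (half_closed u1 u2 v1 ((i, b) :: v2) o) _);
  last by rewrite cat_rcons; apply: IHv.
have far : (i + lower (Cross b) <= m.+1)%N by rewrite addn2 !ltnS.
apply: rst_sym; apply: (isotopic_move (cups m.+1 ++ crossings u1 ++
  (m.+1, Cup true) :: crossings u2 ++ (m, Cross o) :: crossings v1) (crossings v2 ++ _)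
  (Exchange Cap far)).
  by rewrite /= /half_closed_slices -!catA /= -!catA.
rewrite /= /half_closed_slices /crossings map_rcons cat_rcons -!catA /= -!catA.
by rewrite subnK //= ?(leq_trans (leq_addl _ _) far) -?catA.
Qed.

(** Markov's second move, for a stabilizing crossing anywhere in the braid word.
    The minimum and the maximum of the last strand are far apart from the
    crossings of u and v; moved next to the stabilizing crossing, they form with
    it a kink, which the first Reidemeister move removes. *)
Lemma destabilization {m} (u v : braid_word m.+1) o :
  isotopic (braid_closure (widen_braid u ++ (ord_max, o) :: widen_braid v))
           (braid_closure (u ++ v)).
Proof.
have -> : braid_closure (widen_braid u ++ (ord_max, o) :: widen_braid v) =
          half_closed [::] u v [::] o.
  apply: val_inj; rewrite [LHS]closure_slicesE; symmetry.
  transitivity (half_closed_slices [::] u v [::] o) => //; rewrite /half_closed_slices.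
  rewrite crossings_cat [crossings (_ :: _)]/= !crossings_widen (cupsS m.+1) (capsS m.+1).
  by rewrite cat_rcons -!catA.
apply: rst_trans (half_closed_cup _ _ _ _ _) _.
apply: rst_trans (half_closed_cap _ _ _ _ _) _; rewrite cats0 /=.
apply: (isotopic_move (cups m.+1 ++ crossings u) (crossings v ++ caps m.+1)
  (Reidemeister1R m true o)); first by rewrite /= /half_closed_slices -!catA.
by rewrite /= closure_slicesE crossings_cat -!catA.
Qed.

Lemma mirror_closure {m} (w : braid_word m) :
  mirror (braid_closure w) = braid_closure [seq (x.1, ~~ x.2) | x <- w].
Proof.
apply: val_inj; rewrite /= !closure_slicesE !map_cat /crossings -!map_comp.
by congr (_ ++ (_ ++ _)); rewrite /caps ?map_rev -?map_comp.
Qed.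

(** * The substitution y |-> y^-1 *)

Local Notation frac := (@FracField.tofrac {poly {poly rat}}).

Lemma y_neq0 : y != 0.
Proof. by rewrite tofrac_eq0 polyX_eq0. Qed.

Lemma z_neq0 : z != 0.
Proof. by rewrite tofrac_eq0 polyC_eq0 polyX_eq0. Qed.

Lemma fraction_numden {R : idomainType} (f : {fraction R}) :
  f = (FracField.tofrac \n_(repr f)) / (FracField.tofrac \d_(repr f)).
Proof.
have d0 := denom_ratioP (repr f).
rewrite -[LHS]reprK -[in LHS](Ratio_numden (repr f)).
rewrite /FracField.tofrac; unlock.
rewrite -[X in _ = _ * X]FracField.pi_inv -[RHS]FracField.pi_mul.
rewrite /FracField.mulf /FracField.invf !numden_Ratio ?oner_neq0 //.
by rewrite mulr1 mul1r.
Qed.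

Lemma eval_yVE (p : {poly {poly rat}}) :
  eval_yV p = (map_poly (frac \o polyC) p).[y^-1].
Proof. by []. Qed.

Lemma eval_yV_is_zmod_morphism : zmod_morphism eval_yV.
Proof. by move=> p q; rewrite !eval_yVE rmorphB hornerD hornerN. Qed.

Lemma eval_yV_is_monoid_morphism : monoid_morphism eval_yV.
Proof.
by split=> [|p q]; rewrite !eval_yVE ?rmorph1 ?hornerC // rmorphM hornerM.
Qed.

HB.instance Definition _ :=
  GRing.isZmodMorphism.Build _ _ eval_yV eval_yV_is_zmod_morphism.
HB.instance Definition _ :=
  GRing.isMonoidMorphism.Build _ _ eval_yV eval_yV_is_monoid_morphism.

(** Multiplying p(y^-1) by a large enough power of y gives the value at y of the
    reversed polynomial, whose constant term is the leading coefficient of p. *)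
Lemma eval_yV_eq0 p : (eval_yV p == 0) = (p == 0).
Proof.
apply/idP/idP=> [|/eqP->]; last by rewrite rmorph0.
apply: contraTT => p0; set N := size p.
pose q := \poly_(j < N) p`_(N.-1 - j).
have q0 : q != 0.
  apply/negP=> /eqP q0; case/negP: (p0); rewrite -lead_coef_eq0 lead_coefE.
  by move/polyP/(_ 0): q0; rewrite coef_poly coef0 subn0 size_poly_gt0 p0 => ->.
have -> : eval_yV p = frac q / y ^+ N.-1.
  apply: (canRL (mulfK (expf_neq0 _ y_neq0))).
  have size_le : (size (map_poly (frac \o polyC) p) <= N)%N by exact: size_poly.
  rewrite eval_yVE (horner_coef_wide _ size_le) mulr_suml.
  rewrite (reindex_inj rev_ord_inj) /q poly_def rmorph_sum /=.
  apply: eq_bigr => j _; have ltjN := ltn_ord j.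
  rewrite coef_map /= subnS -subn1 subnAC subn1 -mul_polyC rmorphM rmorphXn /=.
  rewrite -mulrA; congr (_ * _); rewrite exprVn.
  apply: (canLR (mulKf (expf_neq0 _ y_neq0))); rewrite -exprD subnK //.
  by rewrite -ltnS (ltn_predK ltjN).
by apply: mulf_neq0; rewrite ?tofrac_eq0 // invr_neq0 // expf_neq0 // y_neq0.
Qed.

(** Independence of the chosen fraction: cross-multiply, and apply the ring
    morphism [eval_yV], which maps nonzero denominators to nonzero elements. *)
Lemma subst_yV_frac p q : q != 0 ->
  subst_yV (frac p / frac q) = eval_yV p / eval_yV q.
Proof.
move=> q0; set f := frac p / frac q; rewrite /subst_yV.
have d0 := denom_ratioP (repr f).
apply/eqP; rewrite eqr_div ?eval_yV_eq0 // -!rmorphM; apply/eqP; congr eval_yV.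
apply/eqP; rewrite -tofrac_eq !tofracM -eqr_div ?tofrac_eq0 //.
by rewrite -fraction_numden.
Qed.

Lemma subst_yV_tofrac p : subst_yV (frac p) = eval_yV p.
Proof.
have -> : frac p = frac p / frac 1 by rewrite rmorph1 divr1.
by rewrite subst_yV_frac ?oner_eq0 // rmorph1 divr1.
Qed.

Lemma subst_yV_is_zmod_morphism : zmod_morphism subst_yV.
Proof.
move=> f g; rewrite {1}(fraction_numden f) {1}(fraction_numden g).
rewrite -mulNr addf_div ?tofrac_eq0 ?denom_ratioP //.
rewrite -rmorphN -!rmorphM -rmorphD subst_yV_frac ?mulf_neq0 ?denom_ratioP //.
rewrite !(rmorphD, rmorphM, rmorphN) /= /subst_yV.
by rewrite -[- (_ / _)]mulNr addf_div ?eval_yV_eq0 ?denom_ratioP.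
Qed.

Lemma subst_yV_is_monoid_morphism : monoid_morphism subst_yV.
Proof.
split=> [|f g].
  by rewrite -[in LHS](rmorph1 frac) subst_yV_tofrac rmorph1.
rewrite {1}(fraction_numden f) {1}(fraction_numden g).
rewrite mulf_div -!rmorphM subst_yV_frac ?mulf_neq0 ?denom_ratioP //.
by rewrite !rmorphM /= /subst_yV mulf_div.
Qed.

HB.instance Definition _ :=
  GRing.isZmodMorphism.Build _ _ subst_yV subst_yV_is_zmod_morphism.
HB.instance Definition _ :=
  GRing.isMonoidMorphism.Build _ _ subst_yV subst_yV_is_monoid_morphism.

Lemma subst_yV_y : subst_yV y = y^-1.
Proof. by rewrite subst_yV_tofrac eval_yVE map_polyX hornerX. Qed.

Lemma subst_yV_z : subst_yV z = z.
Proof. by rewrite subst_yV_tofrac eval_yVE map_polyC hornerC. Qed.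

(** * Recurrences *)

Lemma series_quot_quartic (K : fieldType) (a b c d : K) :
  let g := series_quot 'X^3 (1 - a *: 'X + b *: 'X^2 - c *: 'X^3 + d *: 'X^4) in
  [/\ g 0%N = 0, g 1%N = 0, g 2%N = 0, g 3%N = 1 &
   forall n, g n.+4 = a * g n.+3 - b * g n.+2 + c * g n.+1 - d * g n].
Proof.
set B := (B in series_quot _ B) => g.
have cB i : B`_i = [:: 1; - a; b; - c; d]`_i.
  move: i => [|[|[|[|[|i]]]]]; rewrite /B !coefE /= ?nth_nil; by ring.
have gE n : g n = ('X^3)`_n - \sum_(i < n) B`_(n - i) * g i.
  have := @series_quotP K 'X^3 B n; rewrite big_ord_recr /= subnn cB mul1r.
  by move=> /(_ (oner_neq0 _)) <-; rewrite addrAC subrr add0r.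
have g0 : g 0%N = 0 by rewrite gE coefXn big_ord0 subr0.
have g1 : g 1%N = 0 by rewrite gE coefXn big_ord_recr big_ord0 /= g0; ring.
have g2 : g 2%N = 0.
  by rewrite gE coefXn !big_ord_recr big_ord0 /= g0 g1; ring.
have g3 : g 3%N = 1.
  by rewrite gE coefXn !big_ord_recr big_ord0 /= g0 g1 g2; ring.
split=> // n; rewrite [LHS]gE coefXn !big_ord_recr /= big1 => [|i _].
  by rewrite !(subSS, subSn, leqnn, leqW) // !subnn !cB /=; ring.
by rewrite cB nth_default ?mul0r //= ltn_subRL addn4 !ltnS.
Qed.

Lemma Gtilde_recurrence :
  [/\ Gtilde 0%N = 0, Gtilde 1%N = 0, Gtilde 2%N = 0 & Gtilde 3%N = 1] /\
  forall n, Gtilde n.+4 = (y ^+ 2 * z ^+ 2 - y ^+ 2) * Gtilde n.+3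
    - y ^+ 4 * z ^+ 2 * Gtilde n.+2 + (y ^+ 6 * z ^+ 2 - y ^+ 6) * Gtilde n.+1
    - y ^+ 8 * Gtilde n.
Proof.
have [g0 g1 g2 g3 gE] := series_quot_quartic Qyz (y ^- 2 * z ^+ 2 - y ^- 2)
  (y ^- 4 * z ^+ 2) (y ^- 6 * z ^+ 2 - y ^- 6) (y ^- 8).
rewrite -/G in g0 g1 g2 g3 gE.
have yV k : subst_yV (y ^- k) = y ^+ k.
  by rewrite fmorphV /= rmorphXn /= subst_yV_y exprVn invrK.
split=> [|n].
  by split; rewrite /Gtilde ?g0 ?g1 ?g2 ?g3 ?rmorph0 ?rmorph1.
by rewrite /Gtilde gE !(rmorphD, rmorphN, rmorphM) /= !yV subst_yV_z -expr2.
Qed.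

Lemma linear_rec4_eq (K : pzRingType) (a b c d : K) (u v : nat -> K) :
  (forall n, u n.+4 = a * u n.+3 - b * u n.+2 + c * u n.+1 - d * u n) ->
  (forall n, v n.+4 = a * v n.+3 - b * v n.+2 + c * v n.+1 - d * v n) ->
  [/\ u 0%N = v 0%N, u 1%N = v 1%N, u 2%N = v 2%N & u 3%N = v 3%N] -> u =1 v.
Proof.
move=> uE vE [u0 u1 u2 u3] n.
suff [] : [/\ u n = v n, u n.+1 = v n.+1, u n.+2 = v n.+2 & u n.+3 = v n.+3] by [].
by elim: n => // n [e0 e1 e2 e3]; split=> //; rewrite uE vE e0 e1 e2 e3.
Qed.

(** In the Hecke algebra with generators s and t, braid relation s t s = t s t and
    quadratic relation x^2 = q x - r, the n-th terms of the six sequences are the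
    values of a linear form at b (s t)^n, for b the basis element that their
    names spell.  The hypotheses expand b s t in the basis, except that the last
    one leaves s t s t unexpanded. *)
Lemma hecke3_recurrence (K : comPzRingType) (q r : K)
    (x1 xs xt xst xts xsts : nat -> K) :
  (forall n, x1 n.+1 = xst n) ->
  (forall n, xs n.+1 = q * xst n - r * xt n) ->
  (forall n, xt n.+1 = xsts n) ->
  (forall n, xst n.+1 = q * xsts n - r * xts n) ->
  (forall n, xts n.+1 = q * xsts n - r * (q * xt n - r * x1 n)) ->
  (forall n, xsts n.+1 = q * xst n.+1 - r * (q * xst n - r * xs n)) ->
  forall n, x1 n.+4 = (q ^+ 2 - r) * x1 n.+3 - q ^+ 2 * r * x1 n.+2
     + (q ^+ 2 - r) * r ^+ 2 * x1 n.+1 - r ^+ 4 * x1 n.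
Proof.
by move=> e1 es et est ets ests n; rewrite !(e1, est, ests, ets, et, es); ring.
Qed.

(** The system of [hecke3_recurrence] with q = y z and r = y^2, for a trace whose
    value at a disjoint circle is mu.  The shift by one in the conclusion is
    needed: extended by g(-1) = 0, the sequence g fails its recurrence for the
    terms g(-1), ..., g(3). *)
Lemma homfly_formula (K : fieldType) (y z : K) (g x1 xs xt xst xts xsts : nat -> K) :
  y != 0 -> z != 0 ->
  [/\ g 0%N = 0, g 1%N = 0, g 2%N = 0 & g 3%N = 1] ->
  (forall n, g n.+4 = (y ^+ 2 * z ^+ 2 - y ^+ 2) * g n.+3
     - y ^+ 4 * z ^+ 2 * g n.+2 + (y ^+ 6 * z ^+ 2 - y ^+ 6) * g n.+1
     - y ^+ 8 * g n) ->
  (forall n, x1 n.+1 = xst n) ->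
  (forall n, xs n.+1 = y * z * xst n - y ^+ 2 * xt n) ->
  (forall n, xt n.+1 = xsts n) ->
  (forall n, xst n.+1 = y * z * xsts n - y ^+ 2 * xts n) ->
  (forall n, xts n.+1 = y * z * xsts n - y ^+ 2 * (y * z * xt n - y ^+ 2 * x1 n)) ->
  (forall n, xsts n.+1 = y * z * xst n.+1 - y ^+ 2 * (y * z * xst n - y ^+ 2 * xs n)) ->
  let mu := (y + y^-1) / z in
  [/\ x1 0%N = mu ^+ 2, xs 0%N = mu & xt 0%N = mu] ->
  [/\ xst 0%N = 1, xts 0%N = 1 & xsts 0%N = y * z - y ^+ 2 * mu] ->
  forall n, x1 n.+1 = (y ^- 2 + 1) * z ^- 2 * g n.+4
    + ((1 + y ^+ 2) * z ^- 2 - y ^+ 2) * g n.+3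
    + (y ^+ 6 - (y ^+ 6 + y ^+ 8) * z ^- 2) * g n.+1
    - (y ^+ 8 + y ^+ 10) * z ^- 2 * g n.
Proof.
move=> y0 z0 [g0 g1 g2 g3] gE e1 es et est ets ests mu [i1 i_s i_t] [ist its ists].
apply: (@linear_rec4_eq _ (y ^+ 2 * z ^+ 2 - y ^+ 2) (y ^+ 4 * z ^+ 2)
  (y ^+ 6 * z ^+ 2 - y ^+ 6) (y ^+ 8)).
- move=> n; rewrite (hecke3_recurrence _ _ _ _ _ _ _ _ _ e1 es et est ets ests n.+1).
  ring.
- by move=> n; rewrite !gE; ring.
split; rewrite !(e1, est, ests, ets, et, es, ist, its, ists, i_t, i_s, i1) /mu !gE;
  by rewrite ?g0 ?g1 ?g2 ?g3; field; rewrite ?y0 ?z0.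
Qed.

(** * The HOMFLY polynomial of negative closed 3-braids *)

(** The quadratic relation x^2 = y z x - y^2 satisfied by an inverse Artin
    generator in the Hecke algebra: the skein relation at one of the two
    crossings, where the positive resolution cancels against the other one. *)
Lemma homfly_sigmaV_sq (P : link_diagram -> Qyz) (hP : is_homfly P) m
    (u v : braid_word m) i :
  P (braid_closure (u ++ [:: (i, false), (i, false) & v])) =
  y * z * P (braid_closure (u ++ (i, false) :: v))
  - y ^+ 2 * P (braid_closure (u ++ v)).
Proof.
have := homfly_skein hP (skein_closure u ((i, false) :: v) i).
rewrite (homfly_invariant hP (closure_cancel u v i true)).
move/(congr1 (fun e => y * e)); rewrite mulrDr mulVKf ?y_neq0 //.
by rewrite !mulrA -expr2 => <-; rewrite addrAC subrr add0r.
Qed.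

Lemma homfly_destabilization (P : link_diagram -> Qyz) (hP : is_homfly P) m
    (u v : braid_word m.+1) o :
  P (braid_closure (widen_braid u ++ (ord_max, o) :: widen_braid v)) =
  P (braid_closure (u ++ v)).
Proof. exact/(homfly_invariant hP)/destabilization. Qed.

(** The skein relation at a crossing of the extra strand with its neighbour:
    both signs of the crossing destabilize to the closure of w. *)
Lemma homfly_widen (P : link_diagram -> Qyz) (hP : is_homfly P) m
    (w : braid_word m.+1) :
  P (braid_closure (widen_braid w)) = (y + y^-1) / z * P (braid_closure w).
Proof.
have := homfly_skein hP (skein_closure (widen_braid w) [::] ord_max).
rewrite !(homfly_destabilization _ hP _ w [::]) !cats0 -mulrDl => /esym e.
by apply: (mulfI z_neq0); rewrite e mulrA mulrCA divff ?z_neq0 // mulr1.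
Qed.

Lemma homfly_closure1 (P : link_diagram -> Qyz) (hP : is_homfly P) :
  P (braid_closure ([::] : braid_word 1)) = 1.
Proof. by rewrite -(homfly_unknot hP); congr P; apply: val_inj. Qed.

Lemma homfly_closure2_nil (P : link_diagram -> Qyz) (hP : is_homfly P) :
  P (braid_closure ([::] : braid_word 2)) = (y + y^-1) / z.
Proof.
by rewrite (homfly_widen _ hP _ ([::] : braid_word 1)) homfly_closure1 ?mulr1.
Qed.

Lemma homfly_closure2_generator (P : link_diagram -> Qyz) (hP : is_homfly P) o :
  P (braid_closure ([:: (ord0, o)] : braid_word 2)) = 1.
Proof.
rewrite -(homfly_closure1 _ hP) -(homfly_destabilization _ hP _ [::] [::] o).
by congr (P (braid_closure [:: (_, o)])); apply: val_inj.
Qed.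

(** The indices of the two generators on three strands.  The first one is a
    widened index, so that the words in it alone are, by computation, in the
    image of [widen_braid]. *)
Definition s1 : 'I_2 := widen_ord (leqnSn 1) ord0.
Definition s2 : 'I_2 := ord_max.

Definition negative_braid (w : seq 'I_2) : braid_word 3 :=
  [seq (i, false) | i <- w].

Definition negative_homfly (P : link_diagram -> Qyz) (w : seq 'I_2) : Qyz :=
  P (braid_closure (negative_braid w)).

Lemma negative_homfly_sq (P : link_diagram -> Qyz) (hP : is_homfly P) u v i :
  negative_homfly P (u ++ [:: i, i & v]) =
  y * z * negative_homfly P (u ++ i :: v) - y ^+ 2 * negative_homfly P (u ++ v).
Proof.
by rewrite /negative_homfly /negative_braid !map_cat (homfly_sigmaV_sq _ hP).
Qed.

Lemma negative_homfly_braid (P : link_diagram -> Qyz) (hP : is_homfly P) u v :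
  negative_homfly P (u ++ [:: s2, s1, s2 & v]) =
  negative_homfly P (u ++ [:: s1, s2, s1 & v]).
Proof.
rewrite /negative_homfly /negative_braid !map_cat.
apply/esym/(homfly_invariant hP).
exact: (@closure_braid 3 [seq (i, false) | i <- u] [seq (i, false) | i <- v]
  s1 s2 false erefl).
Qed.

Definition negative_torus_word n : seq 'I_2 := flatten (nseq n [:: s1; s2]).

Lemma torus_link_negative n :
  torus_link (-3) n%:Z = braid_closure (negative_braid (negative_torus_word n)).
Proof.
rewrite [LHS]mirror_closure; congr braid_closure.
have -> : coxeter_braid 3 = [:: (s1, true); (s2, true)].
  rewrite /coxeter_braid (_ : enum _ = [:: s1; s2]) //.
  by apply: (inj_map val_inj); rewrite val_enum_ord.
by rewrite /negative_braid /negative_torus_word /= !map_flatten !map_nseq.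
Qed.

Theorem corollary31 (P : link_diagram -> Qyz) (hP : is_homfly P)
    (n : nat) (hn : (1 <= n)%N) :
  P (torus_link (-3) n%:Z) =
    (y ^- 2 + 1) * z ^- 2 * Gtilde (n + 3)
    + ((1 + y ^+ 2) * z ^- 2 - y ^+ 2) * Gtilde (n + 2)
    + (y ^+ 6 - (y ^+ 6 + y ^+ 8) * z ^- 2) * Gtilde n
    - (y ^+ 8 + y ^+ 10) * z ^- 2 * Gtilde (n - 1).
Proof.
case: n hn => // n _; rewrite torus_link_negative addn3 addn2 subn1 /=.
pose x (b : seq 'I_2) k := negative_homfly P (b ++ negative_torus_word k).
have sq := negative_homfly_sq _ hP; have br := negative_homfly_braid _ hP.
have [g0 gE] := Gtilde_recurrence.
apply: (homfly_formula _ y z Gtilde (x [::]) (x [:: s1]) (x [:: s2])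
  (x [:: s1; s2]) (x [:: s2; s1]) (x [:: s1; s2; s1]) y_neq0 z_neq0 g0 gE).
- by [].
- by move=> k; rewrite /x (sq [::]).
- by move=> k; rewrite /x (br [::]).
- by move=> k; rewrite /x (br [:: s1]) (sq [::]).
- by move=> k; rewrite /x (sq [:: s2]) (br [::]) (sq [::]).
- by move=> k; rewrite /x (sq [:: s1; s2]) (sq [:: s1]).
(* The initial values: generators of index s2 disappear by destabilization, and
   where s2 does not occur, the third strand closes to a disjoint circle. *)
- split; rewrite /x.
  + rewrite expr2 -{2}(homfly_closure2_nil _ hP).
    exact: (homfly_widen _ hP _ ([::] : braid_word 2)).
  + rewrite -[RHS]mulr1 -(homfly_closure2_generator _ hP false).
    exact: (homfly_widen _ hP _ ([:: (ord0, false)] : braid_word 2)).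
  rewrite -(homfly_closure2_nil _ hP).
  exact: (homfly_destabilization _ hP _ ([::] : braid_word 2) [::] false).
split; rewrite /x.
- rewrite -(homfly_closure2_generator _ hP false).
  exact: (homfly_destabilization _ hP _
    ([:: (ord0, false)] : braid_word 2) [::] false).
- rewrite -(homfly_closure2_generator _ hP false).
  exact: (homfly_destabilization _ hP _ [::]
    ([:: (ord0, false)] : braid_word 2) false).
transitivity (P (braid_closure ([:: (ord0, false); (ord0, false)] : braid_word 2))).
  exact: (homfly_destabilization _ hP _
    ([:: (ord0, false)] : braid_word 2) [:: (ord0, false)] false).
rewrite (homfly_sigmaV_sq _ hP 2 [::] [::]) /=.
by rewrite homfly_closure2_generator ?homfly_closure2_nil ?mulr1.
Qed.
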